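(* Let $\overline a,\overline b$ be $\varphi$-equivalent sequences. (1) If $G_\varphi$ has only finitely many (directed) cycles of length $>2$, then $\mathcal L_\varphi(n)=O(n\log n)$, and the constants implied by the $O$-notation are universal. (2) If for some integer $m>2$ the graph $G_\varphi$ has only finitely many cycles of length $>m$, then $\mathcal L_\varphi(n)=O(n^{m-1})$, and the constants implied by the $O$-notation depend only on $m$.
   Context: $\mathbb P$ is the set of positive integers. A partition $\lambda$ is a finite multiset of positive integers; $m_i(\lambda)$ is the number of parts equal to $i$ and $|\lambda|$ the sum of the parts. Let $\overline a=(a_1,a_2,\dots)$, $\overline b=(b_1,b_2,\dots)$ with $a_i,b_i\in\mathbb P\cup\{\infty\}$, and $\operatorname{supp}(\overline a)=\{i:a_i<\infty\}$. The sequences are $\varphi$-equivalent if $\varphi\colon\operatorname{supp}(\overline a)\to\operatorname{supp}(\overline b)$ is a bijection with $ia_i=\varphi(i)b_{\varphi(i)}$ for all $i\in\operatorname{supp}(\overline a)$. Let $\mathcal A$ be the set of partitions $\lambda$ with $m_i(\lambda)<a_i$ for all $i$, and $\mathcal A_n$ those of size $n$. O'Hara's algorithm: on input $\lambda\in\mathcal A$, set $\mu\leftarrow\lambda$; while there is $j$ with $m_j(\mu)\ge b_j$, remove $b_j$ copies of $j$ from $\mu$ and add $a_i$ copies of $i$, where $\varphi(i)=j$; output $\psi(\lambda)=\mu$ (termination and independence of the output and of the number of steps from the choices are known). $L_\varphi(\lambda)$ is the number of steps on input $\lambda$, and $\mathcal L_\varphi(n)=\max_{\lambda\in\mathcal A_n}L_\varphi(\lambda)$.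 $G_\varphi$ is the directed graph on $\operatorname{supp}(\overline a)\cup\operatorname{supp}(\overline b)$ with an edge $i\to j$ whenever $\varphi(j)=i$. $\log$ is the natural logarithm. *)

(* Defs.v *)
From mathcomp Require Import all_boot finmap multiset.
From mathcomp Require Import mathcomp_extra boolp classical_sets functions.
From mathcomp Require Import cardinality.
From mathcomp Require Import zify.

Set Implicit Arguments.
Unset Strict Implicit.
Unset Printing Implicit Defensive.

Local Open Scope classical_set_scope.
Local Open Scope mset_scope.
Local Open Scope nat_scope.

(* A sequence (a_1, a_2, ...) with values in P \cup {oo}: [None] encodes oo and
   the entry at index 0 is never looked at. *)
Definition xseq := nat -> option nat.

Definition xseq_pos (a : xseq) : Prop :=
  forall i k, 0 < i -> a i = Some k -> 0 < k.

Definition supp (a : xseq) : set nat := [set i | 0 < i /\ a i <> None].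

Definition ltx (m : nat) (x : option nat) : bool :=
  if x is Some k then m < k else true.

Definition phi_equivalent (a b : xseq) (phi : nat -> nat) : Prop :=
  [/\ xseq_pos a, xseq_pos b, set_bij (supp a) (supp b) phi &
      forall i k l, supp a i -> a i = Some k -> b (phi i) = Some l ->
        i * k = phi i * l].

Definition is_partition (la : {mset nat}) : Prop := 0 \notin la.

Definition psize (la : {mset nat}) : nat := \sum_(i <- la) i.

Definition restricted (a : xseq) (la : {mset nat}) : Prop :=
  forall i, 0 < i -> ltx (la i) (a i).

Definition partA (a : xseq) : set {mset nat} :=
  [set la | is_partition la /\ restricted a la].

Definition partA_n (a : xseq) (n : nat) : set {mset nat} :=
  [set la | partA a la /\ psize la = n].

Definition ohara_step (a b : xseq) (phi : nat -> nat) (mu nu : {mset nat})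
    : Prop :=
  exists i j k l,
    [/\ supp a i /\ phi i = j, a i = Some k, b j = Some l, l <= mu j &
        nu = (mu `\` msetn l j) `+` msetn k i].

Fixpoint ohara_steps (a b : xseq) (phi : nat -> nat) (k : nat)
    (mu nu : {mset nat}) : Prop :=
  if k is k'.+1
  then exists2 ka, ohara_step a b phi mu ka & ohara_steps a b phi k' ka nu
  else mu = nu.

(* The loop condition "there is j with m_j(mu) >= b_j" fails exactly when
   [restricted b mu]. *)
Definition ohara_run (a b : xseq) (phi : nat -> nat) (la : {mset nat}) (k : nat)
    : Prop :=
  exists2 mu, ohara_steps a b phi k la mu & restricted b mu.

(* The default value 0 is never used on [partA a], and the value does not depend
   on the run chosen by [xget]: see [ohara_lengthP] and [ohara_length_unique]. *)
Definition ohara_length (a b : xseq) (phi : nat -> nat) (la : {mset nat}) : nat :=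
  xget 0 [set k | ohara_run a b phi la k].

(* [fset_set] is meaningful here because of [finite_partA_n]. *)
Definition ohara_max (a b : xseq) (phi : nat -> nat) (n : nat) : nat :=
  \max_(la <- fset_set (partA_n a n)) ohara_length a b phi la.

(* Both ends of an edge lie automatically in [supp a `|` supp b]. *)
Definition Gphi (a : xseq) (phi : nat -> nat) : rel nat :=
  [rel i j | (j \in supp a) && (phi j == i)].

(* A directed cycle is listed once for each of its finitely many starting
   points, which does not affect finiteness. *)
Definition cycles_longer (a : xseq) (phi : nat -> nat) (m : nat)
    : set (seq nat) :=
  [set c | ucycle (Gphi a phi) c /\ m < size c].

Lemma psizeD A B : psize (A `+` B) = psize A + psize B.
Proof.
rewrite /psize -big_cat; apply: perm_big; apply/allP => x _ /=.
by rewrite count_cat !count_mem_mset msetE2.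
Qed.

Lemma psize_msetn k i : psize (msetn k i) = k * i.
Proof. by rewrite /psize enum_msetn big_nseq iter_addn_0 mulnC. Qed.

Lemma psize_bound la x : psize la = la x * x + psize (la `\` msetn (la x) x).
Proof.
rewrite -psize_msetn -psizeD; congr psize; apply/msetP => y.
by rewrite !msetE2 !msetnE; case: eqP => [->|_]; lia.
Qed.

Lemma finite_partitions n :
  finite_set [set la | is_partition la /\ psize la = n].
Proof.
pose f (la : {mset nat}) : {ffun 'I_n.+1 -> 'I_n.+1} := [ffun i : 'I_n.+1 => inord (la i)].
set S := [set la | _].
have bnd la x : S la -> 0 < x -> la x * x <= n.
  by move=> [_ <-] _; rewrite (psize_bound la x) leq_addr.
have finj : {in S &, injective f}.
  move=> la mu /set_mem Sla /set_mem Smu /ffunP e; apply/msetP => x.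
  have [->|x0] := posnP x.
    case: Sla Smu => [/mset_eq0P -> _] [/mset_eq0P -> _] //.
  have [b1 b2] := (bnd _ _ Sla x0, bnd _ _ Smu x0).
  have le y : y * x <= n -> y <= n by apply: leq_trans; rewrite leq_pmulr.
  have [xn|xn] := ltnP x n.+1.
    have := congr1 val (e (Ordinal xn)).
    by rewrite !ffunE /= !inordK // ltnS le.
  have z y : y * x <= n -> y = 0 by case: y => // y; rewrite mulSn; lia.
  by rewrite (z _ b1) (z _ b2).
by rewrite -(eq_finite_set (inj_card_eq finj)).
Qed.

Lemma finite_partA_n a n : finite_set (partA_n a n).
Proof. by apply: sub_finite_set (finite_partitions n) => la [[]]. Qed.

Section Rewriting.
Context {T : Type} (r : T -> T -> Prop).

Fixpoint rsteps k x y : Prop :=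
  if k is k'.+1 then exists2 z, r x z & rsteps k' z y else x = y.

Definition diamond := forall x y z, r x y -> r x z ->
  y = z \/ exists2 w, r y w & r z w.

Lemma rstepsSr k x y :
  rsteps k.+1 x y <-> exists2 z, rsteps k x z & r z y.
Proof.
elim: k x => [|k IH] x; first by split=> [[z rxz <-]|[z <- ?]]; [exists x|exists y].
split=> [[z rxz /IH[w zw wy]]|[w [z rxz zw] wy]].
  by exists w => //; exists z.
by exists z => //; apply/IH; exists w.
Qed.

Lemma diamond_step k x y z : diamond -> rsteps k x y ->
  (forall w, ~ r y w) -> r x z -> exists2 k', k = k'.+1 & rsteps k' z y.
Proof.
move=> D + hy; elim: k x z => [|k IH] x z /=; first by move=> -> /hy.
move=> [x' rxx' st] rxz; exists k => //.
case: (D _ _ _ rxx' rxz) => [<- //|[w r1 r2]].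
by case: (IH _ _ st r1) => k' -> st'; exists w.
Qed.

Lemma diamond_unique k l x y z : diamond ->
  rsteps k x y -> (forall w, ~ r y w) ->
  rsteps l x z -> (forall w, ~ r z w) -> k = l.
Proof.
move=> D + hy + hz; elim: l k x => [|l IH] k x /= st.
  by move=> xz; subst z; case: k st => // k [w /hz].
move=> [w rxw st'].
by case: (diamond_step D st hy rxw) => k' -> /IH ->.
Qed.

End Rewriting.

Lemma rsteps_flip {T} (r : T -> T -> Prop) k x y :
  rsteps r k x y -> rsteps (fun u v => r v u) k y x.
Proof.
elim: k x => [|k IH] x /=; first by move->.
by move=> [z rxz /IH st]; apply/rstepsSr; exists z.
Qed.

Definition fire (D : set nat) (rem add : nat -> {mset nat}) (mu nu : {mset nat})
    : Prop :=
  exists i, [/\ D i, forall x, rem i x <= mu x &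
                nu = (mu `\` rem i) `+` add i].

Lemma fire_flip D rem add mu nu : fire D rem add mu nu <-> fire D add rem nu mu.
Proof.
split=> -[i [Di le ->]]; exists i; split=> //; try by move=> x; rewrite msetE2; lia.
  by apply/msetP => x; rewrite !msetE2; have := le x; lia.
by apply/msetP => x; rewrite !msetE2; have := le x; lia.
Qed.

Lemma fire_diamond D (rem add : nat -> {mset nat}) :
  (forall i j x, D i -> D j -> i <> j -> rem i x = 0 \/ rem j x = 0) ->
  diamond (fire D rem add).
Proof.
move=> dis mu nu1 nu2 [i [Di lei ->]] [j [Dj lej ->]].
have [->|/eqP ij] := eqVneq i j; first by left.
have d x := dis i j x Di Dj ij.
right; exists ((mu `\` rem i `\` rem j) `+` add i `+` add j).
  exists j; split=> // [x|].
    by rewrite !msetE2; have := d x; have := lei x; have := lej x; lia.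
  apply/msetP => x; rewrite !msetE2.
  by have := d x; have := lei x; have := lej x; lia.
exists i; split=> // [x|].
  by rewrite !msetE2; have := d x; have := lei x; have := lej x; lia.
apply/msetP => x; rewrite !msetE2.
by have := d x; have := lei x; have := lej x; lia.
Qed.

Section WellDefined.
Context (a b : xseq) (phi : nat -> nat) (ab : phi_equivalent a b phi).

Let rem i := msetn (odflt 0 (b (phi i))) (phi i).
Let add i := msetn (odflt 0 (a i)) i.
Let F := fire (supp a) rem add.

Let phi_supp i : supp a i -> supp b (phi i).
Proof. by case: ab => _ _ [h _ _] _; apply: h. Qed.

Let phi_inj i j : supp a i -> supp a j -> phi i = phi j -> i = j.
Proof. by case: ab => _ _ [_ h _] _ Si Sj; apply: h; rewrite inE. Qed.

Lemma ohara_stepE mu nu : ohara_step a b phi mu nu <-> F mu nu.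
Proof.
split=> [[i [j [k [l [[Si <-] ak bl le ->]]]]]|[i [Si le ->]]].
  exists i; split; rewrite ?/rem ?/add ?ak ?bl //= => x.
  by rewrite msetnE; case: eqP => [->|].
exists i, (phi i), (odflt 0 (a i)), (odflt 0 (b (phi i))).
have [_ ai] := Si; have [_ bi] := phi_supp Si; have := le (phi i).
by rewrite /rem /add msetnxx; split=> //; [case: (a i) ai|case: (b _) bi].
Qed.

Lemma ohara_stepsE k mu nu : ohara_steps a b phi k mu nu <-> rsteps F k mu nu.
Proof.
elim: k mu => [|k IH] mu //=.
by split=> -[z /ohara_stepE ? /IH ?]; exists z.
Qed.

Let F_diamond : diamond F.
Proof.
apply: fire_diamond => i j x Si Sj ij; rewrite /rem !msetnE.
by case: eqP => [->|_]; [case: eqP => [/phi_inj-/(_ Si Sj)|]|]; tauto.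
Qed.

Let F'_diamond : diamond (fun mu nu => F nu mu).
Proof.
move=> mu nu1 nu2 /fire_flip r1 /fire_flip r2.
have [] := fire_diamond _ r1 r2; first last.
- by move=> [w /fire_flip ? /fire_flip ?]; right; exists w.
- by left.
move=> i j x Si Sj ij; rewrite /add !msetnE.
by case: eqP => [->|_]; [case: eqP|]; tauto.
Qed.

Lemma restricted_halt mu : restricted b mu <-> forall nu, ~ F mu nu.
Proof.
split=> [h nu [i [Si /(_ (phi i)) + _]]|h j j0].
  have [p0 bi] := phi_supp Si; rewrite /rem msetnxx.
  by have := h _ p0; case: (b _) bi => //= l _; lia.
rewrite /ltx; case bj: (b j) => [l|//]; rewrite ltnNge; apply/negP => le.
case: ab => _ _ [_ _ sur] _; have [|i Si ij] := sur j; first by rewrite /supp /= bj.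
apply: (h ((mu `\` rem i) `+` add i)); exists i; split=> // x.
by rewrite /rem ij bj msetnE; case: eqP => [->|].
Qed.

Let restricted_halt' la : restricted a la -> forall nu, ~ F nu la.
Proof.
move=> h nu /fire_flip [i [Si /(_ i) + _]].
have [i0 ai] := Si; rewrite /add msetnxx.
by have := h _ i0; case: (a i) ai => //= k _; lia.
Qed.

Let F_partition mu nu n : F mu nu ->
  is_partition mu /\ psize mu = n -> is_partition nu /\ psize nu = n.
Proof.
move=> [i [Si le ->]] [/mset_eq0P m0 <-].
have [i0 ai] := Si; have [p0 bi] := phi_supp Si; split.
  apply/mset_eq0P; rewrite !msetE2 m0 /add msetnE sub0n.
  by case: eqP i0 => // <-.
have -> : psize mu = psize ((mu `\` rem i) `+` rem i).
  by congr psize; apply/msetP => x; rewrite !msetE2; have := le x; lia.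
rewrite !psizeD /rem /add !psize_msetn; congr (_ + _).
case: ab => _ _ _ /(_ i).
by case: (a i) ai (b _) bi => // k _ [] // l _ /(_ k l Si erefl erefl) /=; lia.
Qed.

Lemma ohara_terminates la : partA a la -> exists k, ohara_run a b phi la k.
Proof.
move=> [pla rla]; apply: contrapT => nrun.
have ex k : exists mu, rsteps F k la mu.
  elim: k => [|k [mu st]]; first by exists la.
  apply: contrapT => nex; apply: nrun; exists k, mu; first exact/ohara_stepsE.
  apply/restricted_halt => nu r; apply: nex; exists nu.
  by apply/rstepsSr; exists mu.
have [f fP] := choice ex.
have finj : {in [set: nat] &, injective f}.
  move=> k l _ _ e; have := rsteps_flip (fP k); have := rsteps_flip (fP l).
  rewrite e => sl sk.
  exact: (diamond_unique F'_diamond sk (restricted_halt' rla) sl (restricted_halt' rla)).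
have : finite_set (f @` [set: nat]).
  apply: sub_finite_set (finite_partitions (psize la)) => _ [k _ <-].
  elim: k (f k) (fP k) => [|k IH] mu; first by move=> <-.
  by move=> /rstepsSr[z /IH h r]; apply: (F_partition r).
by rewrite (eq_finite_set (inj_card_eq finj)); exact: infinite_nat.
Qed.

Lemma ohara_run_unique la k l :
  ohara_run a b phi la k -> ohara_run a b phi la l -> k = l.
Proof.
move=> [mu /ohara_stepsE st /restricted_halt h].
move=> [nu /ohara_stepsE st' /restricted_halt h'].
exact: (diamond_unique F_diamond st h st' h').
Qed.

Lemma ohara_lengthP la :
  partA a la -> ohara_run a b phi la (ohara_length a b phi la).
Proof.
move=> /ohara_terminates h.
exact: (xgetPex 0 (h : exists k, [set k | ohara_run a b phi la k] k)).
Qed.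

Lemma ohara_length_unique la k :
  partA a la -> ohara_run a b phi la k -> k = ohara_length a b phi la.
Proof. by move=> /ohara_lengthP h /ohara_run_unique; apply. Qed.

End WellDefined.

(* Main.v *)
(** Measure a configuration by its masses [j * m_j], so that one step moves the
    mass [i * a_i] along an edge [phi i -> i] of [G_phi], and count the firings
    of each edge separately.  If [i] lies on no cycle, every firing of the edge
    into [i] increases the mass sitting downstream of [i], so there are at most
    [n / i] firings, and these bounds add up to [n * H_n].  If [i] lies on a
    cycle [c], the steps along [c] form a run of their own in which no
    configuration repeats, since the reversed algorithm is confluent and cannot
    leave its starting point.  The mass [s] on [c] is conserved, so there are
    fewer than [(s + 1) ^ (|c| - 1)] such steps.  For [|c| <= m] this is summed
    over all [i] using that the total mass is [n]; each of the finitely many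
    longer cycles carries a bounded initial mass and contributes a constant,
    which is absorbed by [n] for large [n]. *)

Require Import Defs.
From mathcomp Require Import all_boot all_order all_algebra finmap multiset.
From mathcomp Require Import mathcomp_extra boolp classical_sets functions.
From mathcomp Require Import cardinality reals topology sequences exp.
From mathcomp Require Import zify lra.
Import Order.TTheory GRing.Theory Num.Theory.

Set Implicit Arguments.
Unset Strict Implicit.
Unset Printing Implicit Defensive.

Local Open Scope classical_set_scope.
Local Open Scope ring_scope.

(** * Mass carried by a set of part sizes *)

Section Mass.
Local Open Scope mset_scope.
Local Open Scope nat_scope.

Definition mass (P : pred nat) (mu : {mset nat}) : nat :=
  \sum_(x <- mu | P x) x.

Lemma massD P A B : mass P (A `+` B) = mass P A + mass P B.
Proof.
rewrite /mass -big_cat; apply: perm_big; apply/allP => x _ /=.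
by rewrite count_cat !count_mem_mset msetE2.
Qed.

Lemma mass_msetn P k x : mass P (msetn k x) = if P x then k * x else 0.
Proof. by rewrite /mass enum_msetn big_nseq_cond iter_addn_0 mulnC. Qed.

Lemma mass_le_psize P mu : mass P mu <= psize mu.
Proof. by rewrite /mass big_mkcond; apply: leq_sum => x _; case: ifP. Qed.

Lemma mass_mem (c : seq nat) mu :
  uniq c -> mass (mem c) mu = \sum_(x <- c) mu x * x.
Proof.
move=> uc; under eq_bigr => y _ do rewrite -count_mem_mset -sum1_count big_distrl.
rewrite (exchange_big_dep predT) //= /mass big_mkcond; apply: eq_bigr => x _ /=.
under eq_bigl => y do rewrite eq_sym.
have [xc|xc] := boolP (x \in c).
  by rewrite (big_rem x) //= eqxx big1_seq ?mul1n ?addn0 // => y /andP[/eqP->]; rewrite mem_rem_uniqF.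
by rewrite big1_seq // => y /andP[/eqP->]; rewrite (negPf xc).
Qed.

Lemma mass_fire P (mu r d : {mset nat}) : (forall x, r x <= mu x) ->
  mass P (mu `\` r `+` d) + mass P r = mass P mu + mass P d.
Proof.
move=> le; rewrite massD addnAC -massD; congr (mass P _ + _).
by apply/msetP => x; rewrite !msetE2; have := le x; lia.
Qed.

End Mass.

(** * Words of firings and their restriction to a set of indices *)

Section FiringSequences.
Local Open Scope mset_scope.
Local Open Scope nat_scope.
Context (D : set nat) (rem add : nat -> {mset nat}).

(** The word [w] keeps the index fired at each step, which [rsteps] forgets, so that the firings of
    one edge can be counted as letters. *)
Fixpoint fire_seq (w : seq nat) (mu nu : {mset nat}) : Prop :=
  if w is i :: w'
  then [/\ D i, forall x, rem i x <= mu x &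
           fire_seq w' (mu `\` rem i `+` add i) nu]
  else mu = nu.

Lemma rsteps_fire_seq k mu nu :
  rsteps (fire D rem add) k mu nu -> exists2 w, size w = k & fire_seq w mu nu.
Proof.
elim: k mu => [|k IH] mu /=; first by move=> <-; exists [::].
by move=> [z [i [Di le ->]] /IH[w <- fw]]; exists (i :: w).
Qed.

(** By hypothesis an index and a part size on opposite sides of [C] do not interact. Erasing the
    letters outside [C] thus leaves every remaining firing legal, whatever [mu'] is off [C]. *)
Lemma fire_seq_restrict (C : pred nat) w (mu nu mu' : {mset nat}) :
  (forall i x, D i -> C i != C x -> rem i x = 0 /\ add i x = 0) ->
  fire_seq w mu nu -> (forall x, C x -> mu' x = mu x) ->
  exists nu', rsteps (fire (D `&` [set i | C i]) rem add) (count C w) mu' nu'.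
Proof.
move=> loc; elim: w mu mu' => [|i w IH] mu mu' /=; first by move=> _ _; exists mu'.
move=> [Di le fw] eqC; case Ci: (C i) => /=.
  have [x Cx|nu' st] := IH _ (mu' `\` rem i `+` add i) fw.
    by rewrite !msetE2 eqC.
  exists nu', (mu' `\` rem i `+` add i) => //; exists i; split=> // x.
  case Cx: (C x); first by rewrite eqC.
  by have [|->] := loc i x Di; rewrite ?Ci ?Cx.
have [//|nu' st] := IH _ mu' fw _; last by exists nu'.
move=> x Cx; rewrite !msetE2 eqC //.
by have [|-> ->] := loc i x Di; rewrite ?Ci ?Cx // subn0 addn0.
Qed.

Lemma rsteps_fire_off (C : pred nat) k (mu nu : {mset nat}) x :
  (forall i x, D i -> C i != C x -> rem i x = 0 /\ add i x = 0) ->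
  rsteps (fire (D `&` [set i | C i]) rem add) k mu nu -> ~~ C x -> nu x = mu x.
Proof.
move=> loc + Cx; elim: k mu => [|k IH] mu /=; first by move=> ->.
move=> [z [i [[Di Ci] _ ->]] /IH ->]; rewrite !msetE2.
move: Ci => /= Ci.
by have [|-> ->] := loc i x Di; rewrite ?Ci ?(negPf Cx) // subn0 addn0.
Qed.

Lemma rsteps_fire_sub (D' : set nat) k mu nu : (forall i, D' i -> D i) ->
  rsteps (fire D' rem add) k mu nu -> rsteps (fire D rem add) k mu nu.
Proof.
move=> sD; elim: k mu => //= k IH mu [z [i [/sD Di le e]] /IH st].
by exists z => //; exists i.
Qed.

End FiringSequences.

Lemma rsteps_prefix T (r : T -> T -> Prop) t k x y :
  (t <= k)%N -> rsteps r k x y -> exists z, rsteps r t x z.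
Proof.
elim: t k x => [|t IH] [|k] x //= tk; [by exists x|by exists x|].
by move=> [z rxz /(IH _ _ tk)[u st]]; exists u, z.
Qed.

(** * A step of the algorithm as a transfer of mass along an edge *)

Section OHara.
Local Open Scope mset_scope.
Local Open Scope nat_scope.
Context (a b : xseq) (phi : nat -> nat) (ab : phi_equivalent a b phi).

Let rem i := msetn (odflt 0 (b (phi i))) (phi i).
Let add i := msetn (odflt 0 (a i)) i.
Let F := fire (supp a) rem add.

Lemma phi_inj i j : supp a i -> supp a j -> phi i = phi j -> i = j.
Proof. by case: ab => _ _ [_ h _] _ Si Sj; apply: h; rewrite inE. Qed.

Lemma edgeP i j : reflect (supp a j /\ phi j = i) (Gphi a phi i j).
Proof.
apply: (iffP andP) => [[/set_mem Sj /eqP] //|[Sj pj]].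
by split; [exact/mem_set|exact/eqP].
Qed.

Lemma fire_weight i : supp a i ->
  odflt 0 (b (phi i)) * phi i = odflt 0 (a i) * i.
Proof.
move=> Si; have [_ _ [/(_ _ Si)[_ bi] _ _] /(_ i)] := ab; have [_ ai] := Si.
by case: (a i) ai (b _) bi => // k _ [] // l _ /(_ k l Si erefl erefl) /=; lia.
Qed.

Lemma fire_weight_ge i : supp a i -> i <= odflt 0 (a i) * i.
Proof.
move=> Si; have [pa _ _ _] := ab; have [i0 ai] := Si; have := pa i.
by case: (a i) ai => //= k _ /(_ k i0 erefl); nia.
Qed.

Lemma mass_step P (mu : {mset nat}) i : supp a i -> (forall x, rem i x <= mu x) ->
  mass P (mu `\` rem i `+` add i) + (if P (phi i) then odflt 0 (a i) * i else 0)
  = mass P mu + (if P i then odflt 0 (a i) * i else 0).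
Proof.
move=> Si le; have := @mass_fire P mu (rem i) (add i) le.
by rewrite !mass_msetn fire_weight.
Qed.

Lemma psize_fire_seq w mu nu : fire_seq (supp a) rem add w mu nu ->
  psize nu = psize mu.
Proof.
elim: w mu => [|i w IH] mu /=; first by move->.
move=> [Si le /IH ->]; have := @mass_step predT mu i Si le.
by rewrite /= => /addIn.
Qed.

(** Firing [i] creates at least one part equal to [i], and the size is conserved. *)
Lemma fired_le w mu nu i : fire_seq (supp a) rem add w mu nu -> i \in w ->
  0 < i <= psize mu.
Proof.
elim: w mu => [|j w IH] mu //= [Sj le fw]; rewrite inE => /predU1P[->|/(IH _ fw)].
  have [-> _] := Sj; have := @mass_fire predT mu (rem j) (add j) le.
  rewrite massD !mass_msetn /= fire_weight //; have := fire_weight_ge Sj.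
  by rewrite /mass -/(psize mu); lia.
by rewrite (@psize_fire_seq [:: j] mu _ (And3 Sj le erefl)).
Qed.

(** * Edges that lie on no cycle *)

Definition downstream i : pred nat :=
  [pred y | `[< exists2 p, path (Gphi a phi) i p & last i p = y >]].

Lemma downstream_edge i x y :
  Gphi a phi x y -> downstream i x -> downstream i y.
Proof.
move=> exy /asboolP[p ep lp]; apply/asboolP.
by exists (rcons p y); rewrite ?last_rcons // rcons_path ep lp.
Qed.

(** The only edge into [y] comes from [phi y], so a path from [i] that ends at [y] and is not empty
    has passed through [x] just before. *)
Lemma upstream_edge i x y :
  Gphi a phi x y -> downstream i y -> y != i -> downstream i x.
Proof.
move=> /edgeP[_ <-] /asboolP[p]; case/lastP: p => [|p z] /=.
  by move=> _ ->; rewrite eqxx.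
rewrite rcons_path last_rcons => /andP[ep /edgeP[_ pz]] zy _.
by apply/asboolP; exists p; rewrite // -zy pz.
Qed.

(** A path from [i] to [phi i], once made simple, is closed into a cycle by the edge from [phi i] to
    [i]. *)
Lemma acyclic_downstream i : supp a i ->
  ~ (exists2 c, ucycle (Gphi a phi) c & i \in c) -> ~~ downstream i (phi i).
Proof.
move=> Si nc; apply/negP => /asboolP[p ep lp]; apply: nc.
case/shortenP: ep lp => p' ep' up' _ lp'.
exists (i :: p'); last exact: mem_head.
apply/andP; split=> //=; rewrite rcons_path ep' lp'.
by apply/edgeP.
Qed.

(* Only the edge into [i] enters [downstream i], and no edge leaves it. *)
Lemma acyclic_count w mu nu (i : nat) :
  ~ (exists2 c, ucycle (Gphi a phi) c & i \in c) ->
  fire_seq (supp a) rem add w mu nu -> count_mem i w * i <= psize mu.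
Proof.
move=> nc fw; rewrite -(psize_fire_seq fw).
apply: leq_trans (mass_le_psize (downstream i) nu).
suff : count_mem i w * i + mass (downstream i) mu <= mass (downstream i) nu by lia.
elim: w mu fw => [|j w IH] mu /=; first by move=> ->.
move=> [Sj le /IH]; have := mass_step (downstream i) Sj le.
have ej : Gphi a phi (phi j) j by apply/edgeP.
case: (eqVneq j i) Sj ej {le} => [->|ji] Sj ej.
  rewrite (negPf (acyclic_downstream Sj nc)).
  have -> : downstream i i by apply/asboolP; exists [::].
  rewrite addn0 mulnDl mul1n => -> h; apply: leq_trans h.
  by rewrite -addnA [leqLHS]addnC addnA leq_add2l fire_weight_ge.
have -> : downstream i (phi j) = downstream i j.
  apply/idP/idP => [|h]; first exact: downstream_edge.
  exact: upstream_edge ej h ji.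
by rewrite add0n => /addIn ->.
Qed.

(** * Edges that lie on a cycle *)

Lemma cycle_supp c x : ucycle (Gphi a phi) c -> x \in c -> supp a x.
Proof. by move=> /andP[ec _] /(prev_cycle ec)/edgeP[]. Qed.

Lemma cycle_closed c x : ucycle (Gphi a phi) c -> supp a x ->
  (phi x \in c) = (x \in c).
Proof.
move=> /andP[ec _] Sx; apply/idP/idP => [|xc].
  move=> pc; have /edgeP[Sn /phi_inj <- //] := next_cycle ec pc.
  by rewrite mem_next.
by have /edgeP[_ ->] := prev_cycle ec xc; rewrite mem_prev.
Qed.

(** Injectivity of [phi] keeps a walk that starts on [c'] inside [c']. Hence two cycles that meet
    have the same vertices. *)
Lemma cycle_sub c c' x : ucycle (Gphi a phi) c -> ucycle (Gphi a phi) c' ->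
  x \in c -> x \in c' -> {subset c <= c'}.
Proof.
move=> ec ec' xc xc'; have [n p cE] := rot_to xc.
move: ec; rewrite -(rot_ucycle n) cE /ucycle /= rcons_path => /andP[/andP[ep _] _].
suff sp : {subset p <= c'}.
  move=> y; rewrite -(mem_rot n) cE inE => /predU1P[->//|]; exact: sp.
elim: p x ep xc' {xc n cE} => //= y p IH x /andP[/edgeP[Sy <-] ep].
rewrite (cycle_closed ec' Sy) => yc z; rewrite inE => /predU1P[->//|].
exact: IH yc z.
Qed.

Lemma cycle_local c i x : ucycle (Gphi a phi) c -> supp a i ->
  (i \in c) != (x \in c) -> rem i x = 0 /\ add i x = 0.
Proof.
move=> ec Si ne; rewrite /rem /add !msetnE.
case: eqP => [xi|_]; first by rewrite xi cycle_closed // eqxx in ne.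
by case: eqP => [xi|_]; first by rewrite xi eqxx in ne.
Qed.

Lemma mass_cycle_rsteps c k mu nu : ucycle (Gphi a phi) c ->
  rsteps F k mu nu -> mass (mem c) nu = mass (mem c) mu.
Proof.
move=> ec; elim: k mu => [|k IH] mu /=; first by move=> ->.
move=> [z [i [Si le ->]] /IH ->]; have := mass_step (mem c) Si le.
by rewrite /= cycle_closed // => /addIn.
Qed.

(** No firing can produce a restricted [la], so [la] is terminal for reversed firing. The reversed
    relation has the diamond property, hence all its runs from [z] to [la] have equal length. *)
Lemma fire_rsteps_inj la k l z : restricted a la ->
  rsteps F k la z -> rsteps F l la z -> k = l.
Proof.
move=> rla sk sl.
have D : diamond (fun mu nu => F nu mu).
  move=> mu nu1 nu2 /fire_flip r1 /fire_flip r2.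
  have [] := fire_diamond _ r1 r2; first last.
  - by move=> [w /fire_flip ? /fire_flip ?]; right; exists w.
  - by left.
  move=> i j x Si Sj ij; rewrite /add !msetnE.
  by case: eqP => [->|_]; [case: eqP|]; tauto.
have halt nu : ~ F nu la.
  move=> /fire_flip [i [Si /(_ i) + _]].
  have [i0 ai] := Si; rewrite /add msetnxx.
  by have := rla _ i0; case: (a i) ai => //= k' _; lia.
exact: (diamond_unique D (rsteps_flip sk) halt (rsteps_flip sl) halt).
Qed.

(* A configuration of the run along [c] is determined by all but one of its
   multiplicities on [c], the last one being fixed by the mass. *)
Lemma cycle_count c i w la nu : restricted a la ->
  ucycle (Gphi a phi) c -> i \in c -> fire_seq (supp a) rem add w la nu ->
  count_mem i w < (mass (mem c) la).+1 ^ (size c).-1.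
Proof.
move=> rla ec ic fw; set s := mass _ la.
have loc j x : supp a j -> (j \in c) != (x \in c) -> rem j x = 0 /\ add j x = 0.
  exact: cycle_local.
have [nu' st] := @fire_seq_restrict _ _ _ (mem c) _ _ _ la loc fw (fun _ _ => erefl).
set k := count (mem c) w in st.
apply: (@leq_ltn_trans k); first by apply: sub_count => x /= /eqP->.
have ex (t : 'I_k.+1) : exists z,
    rsteps (fire (supp a `&` [set i | i \in c]) rem add) t la z.
  by apply: rsteps_prefix st; rewrite -ltnS.
have [f fP] := choice ex.
have fF (t : 'I_k.+1) : rsteps F t la (f t).
  by apply: rsteps_fire_sub (fP t) => x [].
have fm t : mass (mem c) (f t) = s := mass_cycle_rsteps ec (fF t).
have uc : uniq c by case/andP: ec.
have pos x : x \in c -> 0 < x by move=> /(cycle_supp ec)[].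
have [x0 [p cE]] : exists x0 p, c = x0 :: p.
  by case: (c) ic => // x0 p _; exists x0, p.
(* The head [x0] of the cycle is left out. The other multiplicities are at most [s], so [inord]
   loses nothing, and there are [s.+1 ^ size p] possible values. *)
pose g (t : 'I_k.+1) : {ffun 'I_(size p) -> 'I_s.+1} :=
  [ffun j : 'I_(size p) => inord (f t (nth 0 p j))].
have bnd t x : x \in c -> f t x <= s.
  move=> xc; rewrite -(fm t) mass_mem // (big_rem x) //=.
  by apply: leq_trans (leq_addr _ _); rewrite leq_pmulr // pos.
suff ginj : injective g.
  by have := leq_card g ginj; rewrite card_ffun !card_ord cE.
move=> t u /ffunP gtu; apply/val_inj.
apply: (@fire_rsteps_inj la _ _ (f t) rla (fF t)) => /=; rewrite [f t](_ : _ = f u) //.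
have fp x : x \in p -> f t x = f u x.
  move=> xp; have xn : index x p < size p by rewrite index_mem.
  have := congr1 val (gtu (Ordinal xn)); rewrite !ffunE /= nth_index //.
  by rewrite !inordK // ltnS bnd // cE inE xp orbT.
apply/msetP => x; have [|xc] := boolP (x \in c); last first.
  by rewrite !(rsteps_fire_off loc (fP _) xc).
rewrite cE inE => /predU1P[->|/fp//].
have := fm t; rewrite -(fm u) !mass_mem // cE !big_cons.
rewrite (eq_big_seq (fun x => f u x * x)); last by move=> y /fp ->.
by move/addIn/eqP; rewrite eqn_pmul2r ?pos ?cE ?mem_head // => /eqP.
Qed.

(** * Summation over all edges *)

Lemma size_sum_count n (w : seq nat) : (forall i, i \in w -> i <= n) ->
  size w = \sum_(0 <= i < n.+1) count_mem i w.
Proof.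
elim: w => [|j w IH] le; first by rewrite big1.
rewrite big_split /= -IH => [|i iw]; last by rewrite le // inE iw orbT.
rewrite (big_rem j); last by rewrite mem_index_iota ltnS le ?mem_head.
rewrite eqxx big1_seq // => i /andP[_]; rewrite mem_rem_uniq ?iota_uniq //.
by rewrite inE eq_sym => /andP[/negPf->].
Qed.

(** After exchanging the sums, a part [x] is counted once for each [i] whose chosen cycle contains
    [x]. All such [i] lie on one cycle, so there are at most [m] of them. *)
Lemma sum_cycle_mass m (S : pred nat) (c : nat -> seq nat) n la :
  (forall i, S i -> [/\ ucycle (Gphi a phi) (c i), i \in c i & size (c i) <= m]) ->
  \sum_(0 <= i < n | S i) mass (mem (c i)) la <= m * psize la.
Proof.
move=> cP; rewrite (exchange_big_dep predT) //= /psize big_distrr /=.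
apply: leq_sum => x _; rewrite big_const_seq iter_addn_0 mulnC leq_mul2r.
apply/orP; right; set P := fun _ => _.
have [/hasP[j _ /andP[Sj xj]]|] := boolP (has P (index_iota 0 n)); last first.
  by rewrite has_count -leqNgt leqn0 => /eqP->.
have [ej _ sj] := cP j Sj; apply: leq_trans sj; rewrite -size_filter.
apply: uniq_leq_size => [|i]; first by rewrite filter_uniq ?iota_uniq.
rewrite mem_filter => /andP[/andP[Si xi] _]; have [ei ii _] := cP i Si.
exact: cycle_sub ei ej xi xj _ ii.
Qed.

(** The bound is independent of [la], which makes the contribution of a long cycle a constant. *)
Lemma mass_restricted c la : restricted a la -> ucycle (Gphi a phi) c ->
  mass (mem c) la <= \sum_(x <- c) odflt 0 (a x) * x.
Proof.
move=> rla ec; rewrite mass_mem; last by case/andP: ec.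
rewrite !big_seq; apply: leq_sum => x /(cycle_supp ec)[x0 ax].
by rewrite leq_mul2r; have := rla x x0; case: (a x) ax => //= k _ /ltnW ->; rewrite orbT.
Qed.

Lemma finite_cycle_elements m : finite_set (cycles_longer a phi m) ->
  finite_set [set i | exists2 c, cycles_longer a phi m c & i \in c].
Proof.
move=> fin; apply: (@sub_finite_set _ _ (\bigcup_(c in cycles_longer a phi m) [set` c])).
  by move=> i [c cl ic]; exists c.
by apply: bigcup_finite => // c _; exact: finite_seq.
Qed.

Lemma ohara_max_le m : 1 < m -> finite_set (cycles_longer a phi m) ->
  exists K, forall n, ohara_max a b phi n <=
    \sum_(0 <= i < n.+1) n %/ i + 2 ^ m.-1 * m * n ^ m.-1 + K.
Proof.
move=> m1 /finite_cycle_elements finE.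
pose short i c := [/\ ucycle (Gphi a phi) c, i \in c & size c <= m].
pose long i c := cycles_longer a phi m c /\ i \in c.
have choose (P : nat -> seq nat -> Prop) :
    exists f, forall i, (exists c, P i c) -> P i (f i).
  have ex i : exists c, (exists c', P i c') -> P i c.
    have [[c Pc]|nP] := pselect (exists c, P i c); first by exists c.
    by exists [::] => /nP.
  by have [f fP] := choice ex; exists f.
have [cS cSP] := choose short; have [cL cLP] := choose long.
pose S i := `[< exists c, short i c >]; pose L i := `[< exists c, long i c >].
(* This is the bound of [cycle_count] with the mass replaced by that of [mass_restricted]; it does
   not depend on [n]. *)
pose B i := (\sum_(x <- cL i) odflt 0 (a x) * x).+1 ^ (size (cL i)).-1.
exists (\sum_(i <- fset_set [set i | L i]) B i) => n.
have finL : finite_set [set i | L i].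
  by apply: sub_finite_set finE => i /asboolP[c [cl ic]]; exists c.
apply/bigmax_leqP_seq => la; rewrite in_fset_set; last exact: finite_partA_n.
move=> /set_mem[pla lan] _; have [_ rla] := pla.
have [nu /(ohara_stepsE ab)/rsteps_fire_seq[w <- fw] _] := ohara_lengthP ab pla.
rewrite (@size_sum_count n) => [|i /(fired_le fw)/andP[_]]; last by rewrite lan.
pose s i := mass (mem (cS i)) la.
have sn i : s i <= n by rewrite -lan mass_le_psize.
(* The summands treat in turn an [i] on no cycle, on a short one and on a long one. *)
apply: (@leq_trans (\sum_(0 <= i < n.+1) (n %/ i
    + (if S i then 2 ^ m.-1 * (n ^ m.-2 * s i) else 0) + if L i then B i else 0))).
  apply: leq_sum => i _; case: ifPn => [/asboolP/cSP[ec ic sc]|nS].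
    rewrite addnAC; apply: leq_trans (leq_addl _ _).
    have := cycle_count rla ec ic fw; rewrite -/(s i) => lt.
    have {lt} : count_mem i w < (s i).+1 ^ m.-1.
      by apply: leq_trans lt _; rewrite leq_pexp2l //; lia.
    (* For [s i = 0] the strict bound gives count 0. Otherwise [(s i).+1 <= 2 * s i]; one factor
       [s i] is kept for the summation and the other [m.-2] are bounded by [n]. *)
    case s0: (s i) => [|s']; first by rewrite exp1n; case: count.
    move=> /ltnW/leq_trans; apply; rewrite -s0.
    apply: (@leq_trans ((2 * s i) ^ m.-1)).
      by rewrite leq_exp2r; lia.
    rewrite expnMn leq_mul2l; apply/orP; right.
    have -> : m.-1 = m.-2.+1 by lia.
    rewrite expnSr leq_mul2r; apply/orP; right.
    have [->|m2] := posnP m.-2; first by rewrite !expn0.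
    by rewrite leq_exp2r.
  rewrite addn0; case: ifPn => [/asboolP/cLP[[ec sc] ic]|nL].
    apply: leq_trans (leq_addl _ _); have := cycle_count rla ec ic fw.
    move=> /ltnW/leq_trans; apply; rewrite /B.
    case: (size _).-1 => [|r]; first by rewrite !expn0.
    by rewrite leq_exp2r // ltnS mass_restricted.
  rewrite addn0; have [->|i0] := posnP i.
    rewrite leqn0; apply/eqP/count_memPn/negP.
    by move=> /(fired_le fw)/andP[].
  rewrite leq_divRL // -lan; apply: acyclic_count fw => -[c ec ic].
  have [sc|sc] := leqP (size c) m.
    by move/asboolP: nS; apply; exists c.
  by move/asboolP: nL; apply; exists c.
rewrite !big_split /= leq_add // ?leq_add //.
  rewrite -big_mkcond -!big_distrr /= -mulnA leq_mul2l; apply/orP; right.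
  have -> : m * n ^ m.-1 = n ^ m.-2 * (m * n).
    by have -> : m.-1 = m.-2.+1 by [lia]; rewrite expnSr mulnCA.
  rewrite leq_mul2l; apply/orP; right; rewrite -[X in m * X]lan.
  by apply: sum_cycle_mass => i /asboolP/cSP.
rewrite -big_mkcond; apply: uniq_sub_le_big_cond => //.
- by move=> x y; exact: leq_addr.
- by rewrite filter_uniq ?iota_uniq.
- by rewrite filter_uniq ?fset_uniq.
- move=> i; rewrite !mem_filter /= => /andP[Li _].
  by rewrite in_fset_set //; apply/mem_set.
Qed.

End OHara.

(** * Real estimates and asymptotics *)

Section RealBounds.
Context {R : realType}.

(** The induction step is [ln (1 - 1/x) <= - 1/x] at [x = n + 2]. The term at index 0 vanishes
    because [0^-1 = 0]. *)
Lemma harmonic_le (n : nat) : (0 < n)%N ->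
  \sum_(0 <= i < n.+1) (i%:R : R)^-1 <= 1 + ln (n%:R : R).
Proof.
elim: n => // n IH _; case: n => [|n] in IH *.
  by rewrite !big_nat_recr ?big_geq //= invr0 invr1 ln1 !add0r addr0.
rewrite big_nat_recr //=; apply: le_trans (lerD (IH isT) (lexx _)) _.
set x : R := n.+2%:R; set y : R := n.+1%:R.
have x0 : 0 < x by rewrite ltr0n.
have y0 : 0 < y by rewrite ltr0n.
have xy : x = y + 1 by rewrite /x /y -natr1.
rewrite -addrA lerD2l -lerBrDl -lerN2 opprB -ln_div ?posrE //; have -> : y / x = 1 + - x^-1.
  by rewrite -[y](addrK 1) -xy mulrBl mul1r divff ?gt_eqF.
by apply: le_ln1Dx; rewrite ltrN2 invf_lt1 // xy ltrDr.
Qed.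

Lemma sum_divn_le (n : nat) : (0 < n)%N ->
  (\sum_(0 <= i < n.+1) n %/ i)%N%:R <= n%:R * (1 + ln (n%:R : R)).
Proof.
move=> n0; apply: le_trans (ler_wpM2l (ler0n R n) (harmonic_le n0)).
rewrite natr_sum big_distrr; apply: ler_sum => i _ /=.
have [->|i0] := posnP i; first by rewrite divn0 invr0 mulr0.
by rewrite ler_pdivlMr ?ltr0n // -natrM ler_nat leq_divM.
Qed.

(** The constant [K] depends on the sequences; replacing it by [n] once [K <= n] leaves coefficients
    that depend on [m] alone. *)
Lemma ohara_max_ler a b phi m : phi_equivalent a b phi -> (1 < m)%N ->
  finite_set (cycles_longer a phi m) ->
  \forall n \near \oo, (ohara_max a b phi n)%:R <=
    n%:R * (1 + ln (n%:R : R)) + (2 ^ m.-1 * m)%N%:R * n%:R ^+ m.-1 + n%:R.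
Proof.
move=> ab m1 /(ohara_max_le ab m1)[K le].
near=> n; have Kn : (K <= n)%N by near: n; exact: nbhs_infty_ge.
have n0 : (0 < n)%N by near: n; exact: nbhs_infty_gt.
have := le n; rewrite -(ler_nat R) => /le_trans; apply.
rewrite !natrD natrM natrX !lerD ?sum_divn_le //.
by rewrite ler_nat.
Unshelve. all: by end_near.
Qed.

End RealBounds.

(* "=O" with a constant C chosen before a, b and phi; the threshold from which
   the bound holds may depend on them. *)
Theorem theorem3p6 (R : realType) :
  (exists C : R, forall (a b : xseq) (phi : nat -> nat),
     phi_equivalent a b phi ->
     finite_set (cycles_longer a phi 2) ->
     \forall n \near \oo,
       (ohara_max a b phi n)%:R <= C * (n%:R * ln (n%:R : R)))
  /\
  (forall m : nat, (2 < m)%N ->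
   exists C : R, forall (a b : xseq) (phi : nat -> nat),
     phi_equivalent a b phi ->
     finite_set (cycles_longer a phi m) ->
     \forall n \near \oo,
       (ohara_max a b phi n)%:R <= C * (n%:R : R) ^+ m.-1).
Proof.
split=> [|m m2].
  (* The bound is [n * ln n + 6 * n], where 6 is 1 + 4 + 1, and [n <= n * ln n] as soon as [n] is at
     least e. *)
  exists 7 => a b phi ab /(ohara_max_ler (R := R) (m := 2) ab isT).
  have := nbhs_infty_ger (expR 1 : R); apply: filterS2 => n en /le_trans; apply.
  have n0 : 0 < n%:R :> R by apply: lt_le_trans en; exact: expR_gt0.
  have l1 : 1 <= ln n%:R :> R.
    by rewrite -[leLHS]expRK ler_ln ?posrE ?expR_gt0.
  rewrite expr1 (_ : (2 ^ 2.-1 * 2)%N%:R = 4 :> R) //.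
  have : n%:R <= n%:R * ln n%:R :> R by rewrite ler_peMr // ltW.
  by move: (n%:R) (ln _) => x l; lra.
(* The summand 2 absorbs [n * (1 + ln n) + n]: as [ln n <= n - 1], this is at most
   [n ^ 2 + n <= 2 * n ^ 2], and [2 <= m.-1]. *)
exists (2 ^ m.-1 * m + 2)%N%:R => a b phi ab.
move=> /(ohara_max_ler (R := R) ab (ltnW m2)).
have := nbhs_infty_gt 0; apply: filterS2 => n n0 /le_trans; apply.
have n1 : 1 <= n%:R :> R by rewrite ler1n.
rewrite natrD mulrDl addrAC addrC lerD2l.
apply: (@le_trans _ _ (2 * n%:R ^+ 2)); last first.
  by rewrite ler_pM2l // ler_weXn2l //; lia.
have : ln (n%:R : R) <= n%:R - 1.
  by rewrite -[X in ln X](subrKC 1) le_ln1Dx // ltrBrDr addNr ltr0n.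
by move: (n%:R) (ln _) n1 => x l; nra.
Qed.
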